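(* For $n\ge0$, $$A_n(x,0,g,h\,|\,p,q)=\sum_{k=0}^{\lfloor n/2\rfloor}\gamma^a_{n,k}(0)\,x^k(1+x)^{n-2k},\qquad B_n(x,0,g,h\,|\,t,\alpha)=\sum_{k=0}^{\lfloor n/2\rfloor}\gamma^b_{n,k}(0)\,x^k(1+x)^{n-2k},$$ where $$\gamma^a_{n,k}(0)=\sum_{\sigma\in\mathrm{PRW}_{n+1,k}^{\mathrm{dd}=0}}g^{\mathrm{rmaxpk}(\sigma)-1}h^{\mathrm{D}(\sigma)}p^{(31-2)(\sigma)}q^{(2-13)(\sigma)},$$ $$\gamma^b_{n,k}(0)=\sum_{\sigma\in\mathrm{PRW}_{n+1,k}^{\mathrm{dd}=0}}g^{\mathrm{rmaxpk}(\sigma)-1}h^{\mathrm{D}(\sigma)}t^{\mathrm{lmaxda}(\sigma)}\alpha^{\mathrm{lmax}(\sigma)+\mathrm{rmax}(\sigma)-2}.$$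
   Context: $\mathfrak{S}_N$ is the set of permutations $\sigma=\sigma_1\cdots\sigma_N$ of $[N]$. With the convention $\sigma_0=\sigma_{N+1}=0$, a letter $\sigma_i$ ($i\in[N]$) is a valley if $\sigma_{i-1}>\sigma_i<\sigma_{i+1}$, a peak if $\sigma_{i-1}<\sigma_i>\sigma_{i+1}$, a double ascent if $\sigma_{i-1}<\sigma_i<\sigma_{i+1}$, a double descent if $\sigma_{i-1}>\sigma_i>\sigma_{i+1}$. $\mathrm{Val}(\sigma)$, $\mathrm{Pk}(\sigma)$ are the sets of letters that are valleys, peaks; $\mathrm{dd}(\sigma)$ is the number of double descents; $\mathrm{des}(\sigma)=\#\{1\le i\le N-1:\sigma_i>\sigma_{i+1}\}$. A letter is a left-to-right (resp. right-to-left) maximum if it is larger than all letters to its left (resp. right); $\mathrm{lmax}$, $\mathrm{rmax}$ count these. $\mathrm{lmaxpk}$, $\mathrm{lmaxda}$ count left-to-right maxima that are peaks, resp. double ascents; $\mathrm{rmaxpk}$, $\mathrm{rmaxdd}$ count right-to-left maxima that are peaks, resp. double descents. For $\sigma\in\mathfrak{S}_N$, $\mathrm{D}(\sigma)=\sum_{i\in\mathrm{Pk}(\sigma)\setminus\{N\}}i-\sum_{j\in\mathrm{Val}(\sigma)}j$. $(31\!-\!2)(\sigma)$ is the number of pairs $i<j\le N$ with $\sigma_i>\sigma_j>\sigma_{i+1}$; $(2\!-\!13)(\sigma)$ is the number of pairs $i<j<N$ with $\sigma_j<\sigma_i<\sigma_{j+1}$. $\mathrm{PRW}_N$ is the set of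 $\sigma\in\mathfrak{S}_N$ whose first descent (with $\sigma_{N+1}=0$, so position $N$ counts as a descent here) is at the letter $N$; equivalently $\mathrm{lmaxpk}(\sigma)=1$. E.g. $\mathrm{PRW}_3=\{123,132,231,312,321\}$. $\mathrm{PRW}_{N,k}^{\mathrm{dd}=0}=\{\sigma\in\mathrm{PRW}_N:\mathrm{dd}(\sigma)=0,\ \mathrm{des}(\sigma)=k\}$. Define $$A_n(x,f,g,h\,|\,p,q)=\sum_{\sigma\in\mathfrak{S}_{n+1}}x^{\mathrm{des}(\sigma)}f^{\mathrm{lmaxpk}(\sigma)-1}g^{\mathrm{rmaxpk}(\sigma)-1}h^{\mathrm{D}(\sigma)}p^{(31-2)(\sigma)}q^{(2-13)(\sigma)},$$ $$B_n(x,f,g,h\,|\,t,\alpha)=\sum_{\sigma\in\mathfrak{S}_{n+1}}x^{\mathrm{des}(\sigma)}f^{\mathrm{lmaxpk}(\sigma)-1}g^{\mathrm{rmaxpk}(\sigma)-1}h^{\mathrm{D}(\sigma)}t^{\mathrm{lmaxda}(\sigma)+\mathrm{rmaxdd}(\sigma)}\alpha^{\mathrm{lmax}(\sigma)+\mathrm{rmax}(\sigma)-2};$$ thus, with $0^0=1$, setting $f=0$ restricts both sums to $\sigma\in\mathrm{PRW}_{n+1}$. *)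

(* Defs.v *)
From HB Require Import structures.
From mathcomp Require Import all_boot all_order all_algebra all_fingroup.

Set Implicit Arguments.
Unset Strict Implicit.
Unset Printing Implicit Defensive.

Import GRing.Theory.
Local Open Scope ring_scope.

(* [letter s i] is the i-th letter of the word s_1 ... s_N, with positions and
   letters in {1, ..., N} (whereas 'S_N acts on {0, ..., N-1}); it is 0 at
   i = 0 and at every i > N, which gives the convention s_0 = s_{N+1} = 0. *)
Definition letter (N : nat) (s : 'S_N) (i : nat) : nat :=
  if i is j.+1 then
    if insub j : option 'I_N is Some k then (s k : nat).+1 else 0%N
  else 0%N.

Section Statistics.
Variables (N : nat) (s : 'S_N).
Local Open Scope nat_scope.

Local Notation w := (letter s).
Local Notation positions := (iota 1 N).

Definition valley (i : nat) : bool := (w i.-1 > w i) && (w i < w i.+1).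
Definition peak (i : nat) : bool := (w i.-1 < w i) && (w i > w i.+1).
Definition dasc (i : nat) : bool := (w i.-1 < w i) && (w i < w i.+1).
Definition ddesc (i : nat) : bool := (w i.-1 > w i) && (w i > w i.+1).

Definition Val : seq nat := [seq w i | i <- positions & valley i].
Definition Pk : seq nat := [seq w i | i <- positions & peak i].

Definition dd : nat := count ddesc positions.
Definition des : nat := count (fun i => w i > w i.+1) (iota 1 N.-1).

Definition is_lmax (i : nat) : bool := all (fun j => w j < w i) (iota 1 i.-1).
Definition is_rmax (i : nat) : bool :=
  all (fun j => w j < w i) (iota i.+1 (N - i)).

Definition lmax : nat := count is_lmax positions.
Definition rmax : nat := count is_rmax positions.
Definition lmaxpk : nat := count (fun i => is_lmax i && peak i) positions.
Definition lmaxda : nat := count (fun i => is_lmax i && dasc i) positions.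
Definition rmaxpk : nat := count (fun i => is_rmax i && peak i) positions.
Definition rmaxdd : nat := count (fun i => is_rmax i && ddesc i) positions.

Definition Dstat : int :=
  ((\sum_(a <- Pk | a != N) a)%:Z - (\sum_(b <- Val) b)%:Z)%R.

Definition p31_2 : nat :=
  \sum_(1 <= j < N.+1) \sum_(1 <= i < j) ((w i > w j) && (w j > w i.+1)).

Definition p2_13 : nat :=
  \sum_(1 <= j < N) \sum_(1 <= i < j) ((w j < w i) && (w i < w j.+1)).

(* For N > 0, the position of the first descent; position N always counts as
   a descent here because w N.+1 = 0. *)
Definition first_descent : nat :=
  (find (fun i => w i > w i.+1) positions).+1.

End Statistics.

Definition PRW (N : nat) : {set 'S_N} :=
  [set s : 'S_N | letter s (first_descent s) == N].

Definition PRWdd0 (N k : nat) : {set 'S_N} :=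
  [set s in PRW N | (dd s == 0%N) && (des s == k)].

(* In the exponents below no subtraction of naturals is truncated, since for
   N > 0 the letter N is a peak and both a left-to-right and a right-to-left
   maximum.  [h ^ Dstat s] is a power with exponent in int. *)

Definition A (R : comUnitRingType) (n : nat) (x f g h p q : R) : R :=
  \sum_(s : 'S_n.+1)
    x ^+ des s * f ^+ (lmaxpk s - 1) * g ^+ (rmaxpk s - 1) * h ^ Dstat s
    * p ^+ p31_2 s * q ^+ p2_13 s.

Definition B (R : comUnitRingType) (n : nat) (x f g h t alpha : R) : R :=
  \sum_(s : 'S_n.+1)
    x ^+ des s * f ^+ (lmaxpk s - 1) * g ^+ (rmaxpk s - 1) * h ^ Dstat s
    * t ^+ (lmaxda s + rmaxdd s) * alpha ^+ (lmax s + rmax s - 2).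

(* The coefficients of the gamma-expansions at f = 0. *)

Definition gamma_a0 (R : comUnitRingType) (n k : nat) (g h p q : R) : R :=
  \sum_(s in PRWdd0 n.+1 k)
    g ^+ (rmaxpk s - 1) * h ^ Dstat s * p ^+ p31_2 s * q ^+ p2_13 s.

Definition gamma_b0 (R : comUnitRingType) (n k : nat) (g h t alpha : R) : R :=
  \sum_(s in PRWdd0 n.+1 k)
    g ^+ (rmaxpk s - 1) * h ^ Dstat s * t ^+ lmaxda s
    * alpha ^+ (lmax s + rmax s - 2).

(* Main.v *)
Require Import Defs.
From HB Require Import structures.
From mathcomp Require Import all_boot all_order all_algebra all_fingroup.
From mathcomp Require Import zify ring.
Import GRing.Theory.
Local Open Scope ring_scope.

Set Implicit Arguments.
Unset Strict Implicit.
Unset Printing Implicit Defensive.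

(** Both expansions come from turning double descents into double ascents, one
letter at a time.

Fix a letter v and a word u on the other letters, and pad u with 0 at both
ends.  Comparing the padded word with v gives alternating blocks of smaller and
larger letters, beginning and ending with a smaller block, so the slots of u
at which v has a smaller neighbour on one side and a larger one on the other
form an alternating list U_1, D_1, ..., U_m, D_m.  Inserting v at U_i makes it
a double ascent and inserting it at D_i makes it a double descent.  At any of
these slots v lies strictly between its two neighbours, and therefore changes
nothing for the other letters: each keeps its type (valley, peak, double
ascent, double descent), its status of left-to-right or right-to-left maximum,
and its numbers of crossings (31-2 and 2-13).  This is [profiles_insert].

Only the contribution of v itself depends on the slot, and its sums over the
up slots and over the down slots agree ([balanced]).  At U_i and at D_i alike,
the letter v is crossed by i - 1 descents on its left and by m - i ascents on
its right; this pairs U_i with D_i and settles the weight p^(31-2) q^(2-13).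
For the records, v is a left-to-right maximum and a double ascent exactly at
U_1, a right-to-left maximum and a double descent exactly at D_m, and no
record at any other slot; this pairs U_(i+1) with D_i cyclically and settles
the weight in t and alpha.  (The first pairing is valley hopping; for m >= 2 no
pairing of the slots respects both weights.)

Hence, in the sum over all words, the factor x of v when it is a double
descent may be traded for a factor 1 + x when it is a double ascent and 0 when
it is a double descent.  Doing so for every letter ([toggle]) leaves the words
without double descents, weighted by x^des (1 + x)^da.  Since des = val + dd
and pk = val + 1, a word of length n + 1 with dd = 0 and des = k has n - 2k
double ascents.  Everything read off peaks and valleys is a constant in this
argument; in particular 0^(lmaxpk - 1), the indicator function of PRW, is
([lmaxpk_PRW]). *)

(** * Profiles of letters, and insertion of a letter *)

(** Everything that the statistics see of one occurrence of a letter: whether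
the word rises on entering and on leaving it, its two record statuses, the
number of descents crossing it on its left and of ascents crossing it on its
right. *)
Record profile := Profile {
  value : nat; rise_in : bool; rise_out : bool; ltr_max : bool; rtl_max : bool;
  drops : nat; rises : nat }.

Definition is_peak s := rise_in s && ~~ rise_out s.
Definition is_valley s := ~~ rise_in s && rise_out s.
Definition is_dasc s := rise_in s && rise_out s.
Definition is_ddesc s := ~~ rise_in s && ~~ rise_out s.
(** With distinct letters: double ascent or double descent. *)
Definition flat s := rise_in s == rise_out s.

Definition crossing_drop (z a b : nat) : nat := (b < z < a)%N.
Definition crossing_rise (z a b : nat) : nat := (a < z < b)%N.
(** The padding by 0 or by [z] adds consecutive pairs that never cross [z]: no
descent starts at 0, no ascent ends at 0, and a pair containing [z] does not
cross it.  With it, every insertion point lies between two letters. *)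
Definition drops_in z l := sumn (pairmap (crossing_drop z) 0%N (rcons l z)).
Definition rises_in z r := sumn (pairmap (crossing_rise z) z (rcons r 0%N)).

Definition profile_of (l : seq nat) (z : nat) (r : seq nat) : profile :=
  Profile z (last 0 l < z)%N (z < head 0 r)%N
    (all (fun y => y < z)%N l) (all (fun y => y < z)%N r)
    (drops_in z l) (rises_in z r).

(** The profiles of the letters of [r] in the word [l ++ r]. *)
Fixpoint profiles (l r : seq nat) : seq profile :=
  if r is z :: r' then profile_of l z r' :: profiles (rcons l z) r' else [::].

Lemma sumn_pairmap_insert (f : nat -> nat -> nat) (v x y : nat) s1 s2 :
  (f (last x s1) v + f v (head y s2) = f (last x s1) (head y s2))%N ->
  sumn (pairmap f x (s1 ++ v :: rcons s2 y))
    = sumn (pairmap f x (s1 ++ rcons s2 y)).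
Proof.
move=> E; rewrite !pairmap_cat !sumn_cat; congr (_ + _)%N.
by case: s2 E => [|b s2] /= E; rewrite addnA E.
Qed.

Lemma flat_strict v l r : (0 < v)%N -> v \notin l -> v \notin r ->
  flat (profile_of l v r) ->
  (last 0 l < v < head 0 r)%N || (head 0 r < v < last 0 l)%N.
Proof.
move=> v0 vl vr; rewrite /flat /=.
have : last 0%N l != v.
  case/lastP: l vl => [|l y] /=; first by rewrite eq_sym -lt0n.
  by rewrite mem_rcons last_rcons inE negb_or eq_sym => /andP[].
have : head 0%N r != v.
  case: r vr => [|y r] /=; first by rewrite eq_sym -lt0n.
  by rewrite inE negb_or eq_sym => /andP[].
by move=> ? ? /eqP; lia.
Qed.

(** A letter [z] does not see [v] inserted on its left strictly between its
neighbours: [z] sees [v] smaller (or larger) than itself only if one of the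
two neighbours is, and the step over [v] crosses [z] exactly as often as the
two steps through [v]. *)
Lemma profile_insert_left (v : nat) l1 l2 (z : nat) r : (0 < v)%N ->
  v \notin l1 -> v \notin l2 ++ z :: r -> flat (profile_of l1 v (l2 ++ z :: r)) ->
  profile_of (l1 ++ v :: l2) z r = profile_of (l1 ++ l2) z r.
Proof.
move=> v0 vl vr /(flat_strict v0 vl vr) C.
have vz : v != z.
  by move: vr; rewrite mem_cat inE !negb_or => /and3P[].
have Ch : head 0%N (l2 ++ z :: r) = head z l2 by case: (l2).
rewrite Ch in C.
congr Profile.
- case/lastP: l2 C {vr Ch} => [|l2 y] /=.
    by rewrite cats1 cats0 last_rcons; lia.
  by rewrite -rcons_cons -!rcons_cat !last_rcons.
- rewrite !all_cat /=; case: (all _ l1) / idP => //= a1.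
  case: (all _ l2) / idP => a2; rewrite ?andbF // andbT.
  have h1 : (head z l2 <= z)%N.
    by case: l2 C a2 {vr Ch} => //= y l2 _ /andP[/ltnW].
  case/lastP: l1 C a1 {vl} => [|l1 y] /=; first by move=> C _; lia.
  by rewrite last_rcons all_rcons => C /andP[]; lia.
- rewrite /drops_in !rcons_cat rcons_cons; apply: sumn_pairmap_insert.
  by rewrite /crossing_drop; move: C vz; lia.
Qed.

Lemma profile_insert_right (v : nat) l (z : nat) r1 r2 : (0 < v)%N ->
  v \notin l ++ z :: r1 -> v \notin r2 -> flat (profile_of (l ++ z :: r1) v r2) ->
  profile_of l z (r1 ++ v :: r2) = profile_of l z (r1 ++ r2).
Proof.
move=> v0 vl vr /(flat_strict v0 vl vr) C.
have vz : v != z.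
  by move: vl; rewrite mem_cat inE !negb_or => /and3P[].
rewrite last_cat /= in C.
congr Profile.
- case: r1 C {vl} => [|y r1] //=.
  by move: vz; lia.
- rewrite !all_cat /=; case: (all _ r1) / idP => //= a1.
  case: (all _ r2) / idP => a2; rewrite ?andbF // andbT.
  have h1 : (last z r1 <= z)%N.
    case/lastP: r1 C a1 {vl} => //= r1 y _.
    by rewrite last_rcons all_rcons => /andP[/ltnW].
  by case: r2 C a2 {vr} => [|y r2] /=; lia.
- rewrite /rises_in !rcons_cat rcons_cons; apply: sumn_pairmap_insert.
  by rewrite /crossing_rise; move: C vz; lia.
Qed.

Lemma map_value_profiles l r : map value (profiles l r) = r.
Proof. by elim: r l => //= z r IH l; rewrite IH. Qed.

Lemma profiles_insert_left v l1 l2 r : (0 < v)%N ->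
  v \notin l1 -> v \notin l2 ++ r -> flat (profile_of l1 v (l2 ++ r)) ->
  profiles (l1 ++ v :: l2) r = profiles (l1 ++ l2) r.
Proof.
move=> v0 vl; elim: r l2 => //= z r IH l2 vr fl.
rewrite (profile_insert_left v0 vl vr fl) !rcons_cat rcons_cons IH //.
  by rewrite cat_rcons.
by rewrite cat_rcons.
Qed.

(** Insertion of [v] adds its profile to the list and, at a flat slot, leaves
the other profiles untouched. *)
Lemma profiles_insert v l r1 r2 : (0 < v)%N ->
  v \notin l ++ r1 -> v \notin r2 ->
  exists a b, [/\ profiles l (r1 ++ v :: r2) = a ++ profile_of (l ++ r1) v r2 :: b,
    map value a = r1, map value b = r2 &
    flat (profile_of (l ++ r1) v r2) -> profiles l (r1 ++ r2) = a ++ b].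
Proof.
move=> v0 + vr; elim: r1 l => [|z r1 IH] l /= vl.
  exists [::], (profiles (rcons l v) r2); split => //=; first by rewrite cats0.
    by rewrite map_value_profiles.
  rewrite cats0 in vl *.
  by move=> fl; rewrite -cats1 (profiles_insert_left (l2 := [::])) ?cats0.
have [a [b [E ea eb H]]] : exists a b, [/\ profiles (rcons l z) (r1 ++ v :: r2)
    = a ++ profile_of (l ++ z :: r1) v r2 :: b, map value a = r1, map value b = r2 &
    flat (profile_of (l ++ z :: r1) v r2) -> profiles (rcons l z) (r1 ++ r2) = a ++ b].
  by rewrite -cat_rcons; apply: IH; rewrite cat_rcons.
exists (profile_of l z (r1 ++ v :: r2) :: a), b; split => //=; try by rewrite ?E ?ea.
by move=> fl; rewrite H // profile_insert_right.
Qed.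

(** The ways to cut [l ++ r] at or after the end of [l]; the accumulator [l]
is what makes the slot sums below amenable to induction. *)
Fixpoint cuts (l r : seq nat) : seq (seq nat * seq nat) :=
  (l, r) :: if r is b :: r' then cuts (rcons l b) r' else [::].

Lemma mem_cuts l r c :
  (c \in cuts l r) = (size l <= size c.1)%N && (c.1 ++ c.2 == l ++ r).
Proof.
elim: r l c => [|b r IH] l c /=; rewrite inE ?in_nil ?orbF ?IH.
  rewrite cats0; apply/eqP/andP => [-> /=|[h /eqP e]]; first by rewrite cats0.
  case: c h e => c1 [|y c2] /=; first by rewrite cats0 => _ ->.
  by move=> h e; move: h; rewrite -e size_cat /=; lia.
rewrite cat_rcons size_rcons.
apply/orP/andP => [[/eqP ->//|/andP[/ltnW -> ->]//]|[]].
rewrite leq_eqVlt => /orP[/eqP h|->]; last by move=> ->; right.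
rewrite eqseq_cat // => /andP[/eqP e1 /eqP e2]; left.
by case: c h e1 e2 => /= ? ? _ <- <-.
Qed.

Lemma cuts_uniq l r : uniq (cuts l r).
Proof.
elim: r l => //= b r IH l; rewrite IH andbT mem_cuts /= size_rcons.
by rewrite ltnn.
Qed.

Lemma perm_permutations_insert (s : seq nat) v : v \in s -> uniq s ->
  perm_eq (permutations s)
    [seq c.1 ++ v :: c.2 | u <- permutations (rem v s), c <- cuts [::] u].
Proof.
move=> vs us.
have nv u c : u \in permutations (rem v s) -> c \in cuts [::] u ->
    v \notin c.1 ++ c.2.
  rewrite mem_permutations mem_cuts => /perm_mem E /andP[_ /eqP->].
  by rewrite /= E mem_rem_uniq // inE eqxx.
apply: uniq_perm.
- exact: permutations_uniq.
- apply: (@allpairs_uniq_dep _ (fun=> _) _ (fun _ c => c.1 ++ v :: c.2)).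
  + exact: permutations_uniq.
  + by move=> u _; apply: cuts_uniq.
  move=> p q /allpairsPdep[u [c [pu pc ->]]] /allpairsPdep[u' [c' [pu' pc' ->]]] /=.
  have := nv _ _ pu pc; have := nv _ _ pu' pc'.
  rewrite !mem_cat !negb_or => /andP[a1 a2] /andP[b1 b2] e.
  have ec : c = c'.
    have e1 : c.1 = c'.1.
      have := congr1 (fun w => take (index v w) w) e.
      by rewrite /= !index_cat (negPf a1) (negPf b1) /= !eqxx !addn0 !take_size_cat.
    case: c c' e e1 {pc pc' a1 a2 b1 b2} => [x y] [x' y'] /= e e1.
    move: e; rewrite e1 => /eqP.
    by rewrite eqseq_cat // !eqxx /= eqseq_cons eqxx => /eqP->.
  move: pc pc'; rewrite -ec !mem_cuts => /andP[_ /eqP h1] /andP[_ /eqP h2].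
  by move: h1; rewrite h2 /= => ->.
move=> w; rewrite mem_permutations; apply/idP/allpairsPdep => [pw|].
  have vw : v \in w by rewrite (perm_mem pw).
  case/splitPr: vw pw => l r pw.
  exists (l ++ r), (l, r); split=> //=.
    rewrite mem_permutations -(perm_cons v).
    rewrite -(permPr (perm_to_rem vs)) -(permPr pw) -[v :: r]cat1s.
    by rewrite perm_sym perm_catCA.
  by rewrite mem_cuts /= eqxx.
move=> [u [c [pu]]]; rewrite mem_cuts => /andP[_ /eqP /= ec] ->.
rewrite -cat1s perm_catCA ec /= (permPr (perm_to_rem vs)) perm_cons.
by rewrite -mem_permutations.
Qed.

(** * Sums over the slots of a letter *)

Lemma drops_in_rcons (v b : nat) l :
  drops_in v (rcons l b) = (drops_in v l + crossing_drop v (last 0%N l) b)%N.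
Proof.
rewrite /drops_in -!cats1 !pairmap_cat !sumn_cat /= last_cat /= /crossing_drop.
by rewrite !ltnn !addn0.
Qed.

Lemma rises_in_cons (v b : nat) r :
  rises_in v (b :: r) = (crossing_rise v b (head 0%N r) + rises_in v r)%N.
Proof.
rewrite /rises_in; case: r => [|a r] /=; rewrite /crossing_rise !ltnn //=.
Qed.

Section Balance.
Variables (R : comNzRingType) (v : nat).

Definition slot_sum (P : pred profile) (rho : profile -> R) l r :=
  \sum_(c <- cuts l r | P (profile_of c.1 v c.2)) rho (profile_of c.1 v c.2).

Lemma slot_sum_cons P rho l b r :
  slot_sum P rho l (b :: r)
    = (if P (profile_of l v (b :: r)) then rho (profile_of l v (b :: r)) else 0)
      + slot_sum P rho (rcons l b) r.
Proof. by rewrite /slot_sum /= big_cons /=; case: ifP; rewrite ?add0r. Qed.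

Lemma slot_sum_nil P rho l :
  slot_sum P rho l [::]
    = if P (profile_of l v [::]) then rho (profile_of l v [::]) else 0.
Proof. by rewrite /slot_sum /= big_cons big_nil /=; case: ifP; rewrite ?addr0. Qed.

(** Sweeping from left to right, flat slots alternate between up and down and
consecutive slots U_i, D_i see the same two counts.  Hence a sweep starting
above [v] meets one unpaired down slot, the next one. *)
Lemma slot_sum_crossings (G : nat -> nat -> R) l r : v \notin r ->
  let rho p := G (drops p) (rises p) in
  slot_sum is_ddesc rho l r
    = slot_sum is_dasc rho l r
      + (if (last 0 l < v)%N then 0 else G (drops_in v l) (rises_in v r)).
Proof.
move=> + rho; elim: r l => [|b r IH] l.
  move=> _; rewrite !slot_sum_nil /is_ddesc /is_dasc /= !ltn0 !andbF !andbT add0r /rho.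
  by case: (last 0%N l < v)%N.
rewrite inE negb_or => /andP[vb vr].
rewrite !slot_sum_cons (IH _ vr) last_rcons /is_ddesc /is_dasc /= /rho /=.
rewrite drops_in_rcons rises_in_cons /crossing_drop /crossing_rise.
case: (ltngtP v b) vb => // vb _ /=; case: (last 0%N l < v)%N => /=.
- by rewrite add0n addn0 addr0 add0r addrC.
- by rewrite add0n addn0 !add0r.
- by rewrite !addr0.
- by rewrite addr0 add0r addrC.
Qed.

(** Every slot has weight 1 except U_1 and the last down slot, which have
weight [tau].  From below [v], a sweep meets as many up slots as down slots:
none if no letter of [r] exceeds [v]; otherwise it meets the last down slot,
and it meets U_1 iff no letter of [l] exceeds [v].  From above [v], U_1 has
been passed and there is one more down slot than up slots. *)
Lemma slot_sum_records (tau : R) l r : (0 < v)%N -> v \notin l ++ r ->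
  let rho p := tau ^+ (is_dasc p && ltr_max p || is_ddesc p && rtl_max p) in
  slot_sum is_ddesc rho l r
    = slot_sum is_dasc rho l r +
      (if (last 0 l < v)%N then
         if all (fun y => y < v)%N l || all (fun y => y < v)%N r then 0
         else tau - 1
       else tau).
Proof.
move=> v_gt0 + rho; elim: r l => [|b r IH] l.
  move=> _; rewrite !slot_sum_nil /rho /is_ddesc /is_dasc /=.
  rewrite !ltn0 !andbF !andbT add0r orbT.
  by case: (last 0%N l < v)%N.
rewrite -cat_rcons => vn; have vb : v != b.
  by move: vn; rewrite mem_cat mem_rcons inE !negb_or => /andP[/andP[]].
rewrite !slot_sum_cons (IH _ vn) last_rcons all_rcons /rho /is_ddesc /is_dasc /=.
have alow : all (fun y => y < v)%N l -> (last 0%N l < v)%N.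
  by case/lastP: (l) => //= l' y; rewrite last_rcons all_rcons => /andP[].
move: (all _ l) (all _ r) alow => al ar alow.
case: (ltngtP v b) vb => // vb _ /=; case: (last 0%N l < v)%N alow => /=;
  case: al => //= alow; try (by have := alow isT); case: ar;
  rewrite ?expr0 ?expr1; ring.
Qed.

End Balance.

(** * Trading double descents for double ascents *)

Section Exchange.
Variable R : comNzRingType.
Implicit Types (K : seq profile -> R) (w rho : profile -> R).

(** What remains of a word when a single double ascent or double descent is
moved from one flat slot to another. *)
Definition skeleton S := [seq p <- S | ~~ flat p].

Definition word_weight K w u :=
  K (skeleton (profiles [::] u)) * \prod_(p <- profiles [::] u) w p.

Lemma eq_prod_notin w1 w2 v (S : seq profile) :
  v \notin map value S -> (forall p, value p != v -> w1 p = w2 p) ->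
  \prod_(p <- S) w1 p = \prod_(p <- S) w2 p.
Proof.
move=> + e; elim: S => [|p S IH] /=; first by rewrite !big_nil.
by rewrite inE negb_or eq_sym !big_cons => /andP[/e-> /IH->].
Qed.

(** Group the words by what is left after erasing [v].  On a non-flat slot the
two weights agree factor by factor; on the flat ones all factors but that of
[v] are constant, so that only the slot sums of [v] matter. *)
Lemma change_weight_at K w1 w2 v s : (0 < v)%N -> v \in s -> uniq s ->
  (forall p, value p != v -> w1 p = w2 p) ->
  (forall p, ~~ flat p -> w1 p = w2 p) ->
  (forall u, v \notin u ->
     slot_sum v flat w1 [::] u = slot_sum v flat w2 [::] u) ->
  \sum_(u <- permutations s) word_weight K w1 u
    = \sum_(u <- permutations s) word_weight K w2 u.
Proof.
move=> v0 vs us ev ef es.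
rewrite !(perm_big _ (perm_permutations_insert vs us)) !big_allpairs_dep.
apply: eq_big_seq => u /=; rewrite mem_permutations => /perm_mem pu.
have vu : v \notin u by rewrite pu mem_rem_uniq // inE eqxx.
have cutP c : c \in cuts [::] u ->
    [/\ v \notin c.1, v \notin c.2 & u = c.1 ++ c.2].
  rewrite mem_cuts /= => /eqP e; move: vu; rewrite -e mem_cat negb_or.
  by case/andP.
pose flat_cut c := flat (profile_of c.1 v c.2).
rewrite (bigID flat_cut) [RHS](bigID flat_cut) /= /flat_cut {flat_cut}.
congr (_ + _); last first.
  rewrite [LHS]big_seq_cond [RHS]big_seq_cond.
  apply: eq_bigr => -[l r] /= /andP[/cutP[/= vl vr _] nf].
  rewrite /word_weight; congr (_ * _).
  have [a [b [-> ea eb _]]] := profiles_insert (l := [::]) v0 vl vr.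
  rewrite !big_cat !big_cons /=; congr (_ * (_ * _)); last 1 first.
  - by apply: eq_prod_notin ev; rewrite eb.
  - by apply: eq_prod_notin ev; rewrite ea.
  - exact: ef.
suff fl w : (forall p, value p != v -> w1 p = w p) ->
    \sum_(c <- cuts [::] u | flat (profile_of c.1 v c.2))
      word_weight K w (c.1 ++ v :: c.2)
    = word_weight K w1 u * slot_sum v flat w [::] u.
  by rewrite !fl // es.
move=> ew; rewrite /slot_sum big_distrr /=.
rewrite [LHS]big_seq_cond [RHS]big_seq_cond.
apply: eq_bigr => -[l r] /= /andP[/cutP[/= vl vr ->] f].
have [a [b [E ea eb /(_ f) E0]]] := profiles_insert (l := [::]) v0 vl vr.
rewrite /word_weight [profiles _ (l ++ r)]E0 E /skeleton !filter_cat /= f /= -mulrA.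
congr (_ * _); rewrite !big_cat big_cons /=.
rewrite (eq_prod_notin (S := a) _ ew) ?ea // (eq_prod_notin (S := b) _ ew) ?eb //.
by rewrite -mulrA; congr (_ * _); rewrite mulrC.
Qed.

Definition balanced rho := forall u v, (0 < v)%N -> v \notin u ->
  slot_sum v is_dasc rho [::] u = slot_sum v is_ddesc rho [::] u.

Definition marked x p : R := if is_ddesc p then x else 1.
Definition resolved x p : R :=
  if is_ddesc p then 0 else if is_dasc p then 1 + x else 1.

(** The letters are converted in increasing order, [W j] being the weight when
those below [j] have been.  At [j], with U the sum of [rho] over the up slots,
which is also the sum over the down slots, U + U * x = U * (1 + x) + U * 0. *)
Lemma toggle K rho x s : balanced rho -> uniq s -> 0%N \notin s ->
  \sum_(u <- permutations s) word_weight K (fun p => rho p * marked x p) u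
  = \sum_(u <- permutations s) word_weight K (fun p => rho p * resolved x p) u.
Proof.
move=> bal us s0.
pose W j p := rho p * (if (value p < j)%N then resolved x p else marked x p).
have step j : \sum_(u <- permutations s) word_weight K (W 0%N) u
    = \sum_(u <- permutations s) word_weight K (W j) u.
  elim: j => // j ->.
  have eW p : value p != j -> W j p = W j.+1 p.
    by move=> pj; rewrite /W ltnS [in RHS]leq_eqVlt (negPf pj).
  case: (boolP (j \in s)) => js; last first.
    apply: eq_big_seq => u; rewrite mem_permutations => /perm_mem pu.
    rewrite /word_weight; congr (_ * _); apply: eq_prod_notin eW.
    by rewrite map_value_profiles pu.
  have j0 : (0 < j)%N by case: (j) js s0 => // ->.
  apply: (change_weight_at _ j0 js us eW) => [p|u ju].
    rewrite /W /resolved /marked /is_ddesc /is_dasc /flat.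
    by case: (rise_in p) (rise_out p) => -[] //= _; rewrite !if_same.
  have split w : slot_sum j flat w [::] u =
      slot_sum j is_dasc w [::] u + slot_sum j is_ddesc w [::] u.
    rewrite /slot_sum (bigID (fun c => rise_in (profile_of c.1 j c.2))) /=.
    congr (_ + _); apply: eq_bigl => c; rewrite /flat /is_dasc /is_ddesc /=;
    by case: (_ < j)%N (j < _)%N => -[].
  have pull (P : pred profile) w (a : R) :
      (forall p, P p -> value p = j -> w p = rho p * a) ->
      slot_sum j P w [::] u = slot_sum j P rho [::] u * a.
    move=> e; rewrite /slot_sum big_distrl; apply: eq_bigr => c Pc.
    exact: e.
  rewrite !split.
  rewrite (pull is_dasc (W j) 1); last first.
    by move=> p /andP[a b] pj; rewrite /W pj ltnn /marked /is_ddesc a.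
  rewrite (pull is_ddesc (W j) x); last first.
    by move=> p a pj; rewrite /W pj ltnn /marked a.
  rewrite (pull is_dasc (W j.+1) (1 + x)); last first.
    move=> p a pj; rewrite /W pj leqnn /resolved a.
    by case/andP: a => a b; rewrite /is_ddesc a.
  rewrite (pull is_ddesc (W j.+1) 0); last first.
    by move=> p a pj; rewrite /W pj leqnn /resolved a.
  by rewrite -(bal u j j0 ju); ring.
rewrite -/(W 0%N) (step (\max_(y <- s) y).+1).
apply: eq_big_seq => u; rewrite mem_permutations => pu.
rewrite /word_weight; congr (_ * _).
have: all (fun p => (value p < (\max_(y <- s) y).+1)%N) (profiles [::] u).
  rewrite -(all_map value (fun y => y < _)%N) map_value_profiles (perm_all _ pu).
  by apply/allP => y ys; rewrite ltnS (big_rem y) //= leq_maxl.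
elim: (profiles _ _) => [|p S IH] /=; first by rewrite !big_nil.
by rewrite !big_cons => /andP[lp /IH->]; rewrite /W lp.
Qed.

Lemma balanced_crossings (p q : R) :
  balanced (fun s => p ^+ drops s * q ^+ rises s).
Proof.
move=> u v v0 vu; have := slot_sum_crossings (fun i j => p ^+ i * q ^+ j) [::] vu.
by move=> /= ->; rewrite v0 addr0.
Qed.

Lemma balanced_records (tau : R) :
  balanced (fun s => tau ^+ (is_dasc s && ltr_max s || is_ddesc s && rtl_max s)).
Proof.
move=> u v v0 vu; have := slot_sum_records tau (l := [::]) v0 vu.
by move=> /= ->; rewrite v0 addr0.
Qed.

End Exchange.

(** * Permutations as words, and their statistics as sums over profiles *)

#[local] Arguments letter : simpl never.

(** In (2-13) the outer sum is over the ascent, whereas profiles are indexed by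
the letter that is crossed. *)
Lemma exchange_triangle (F : nat -> nat -> nat) N : (0 < N)%N ->
  (forall i, F i i = 0%N) -> (forall i, F i N = 0%N) ->
  (\sum_(1 <= j < N) \sum_(1 <= i < j) F i j
    = \sum_(1 <= i < N.+1) \sum_(i <= j < N.+1) F i j)%N.
Proof.
move=> N0 F_diag F_last.
transitivity (\sum_(1 <= i < N.+1) \sum_(1 <= j < N.+1 | i <= j) F i j)%N; last first.
  rewrite big_nat [RHS]big_nat; apply: eq_bigr => i /andP[i0 _].
  by rewrite [RHS](@big_nat_widenl _ _ _ i 1).
rewrite (@exchange_big_dep_nat _ _ _ 1 N.+1 1 N.+1 xpredT leq xpredT) //=.
rewrite big_nat_recr //= [X in (_ = _ + X)%N]big1 ?addn0 => [|i _]; last exact: F_last.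
rewrite !big_nat; apply: eq_bigr => j /andP[j0 jN].
transitivity (\sum_(1 <= i < j.+1) F i j)%N.
  by rewrite big_nat_recr //= F_diag addn0.
by rewrite (@big_nat_widen _ _ _ 1 j.+1 N.+1) 1?ltnW.
Qed.

Section Letters.
Variables (N : nat) (s : 'S_N).
Local Open Scope nat_scope.
Local Notation w := (letter s).

Lemma letter_ord (i : 'I_N) : w i.+1 = (s i).+1.
Proof. by rewrite /letter valK. Qed.

Lemma letter_out i : N < i -> w i = 0.
Proof. by case: i => // i h; rewrite /letter insubF // ltnNge -ltnS h. Qed.

Lemma position_ord i : i \in iota 1 N -> exists j : 'I_N, i = j.+1.
Proof.
rewrite mem_iota add1n; case: i => // i; rewrite ltnS /= => h.
by exists (@Ordinal N i h).
Qed.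

Lemma letter_gt0 i : i \in iota 1 N -> 0 < w i.
Proof. by case/position_ord => j ->; rewrite letter_ord. Qed.

Lemma letter_le i : w i <= N.
Proof.
case: (leqP i N) => [h|/letter_out->//]; case: i h => // i h.
by rewrite (letter_ord (@Ordinal N i h)) ltn_ord.
Qed.

Lemma letter_inj : {in iota 1 N &, injective w}.
Proof.
move=> _ _ /position_ord[i ->] /position_ord[j ->].
by rewrite !letter_ord => -[] /val_inj /perm_inj ->.
Qed.

Lemma letter_adjacent i : 0 < N -> i <= N -> w i != w i.+1.
Proof.
move=> N0; rewrite leq_eqVlt => /orP[/eqP->|iN].
  by rewrite (@letter_out N.+1) // -lt0n letter_gt0 // mem_iota; lia.
case: i iN => [|i] iN; first by rewrite eq_sym -lt0n letter_gt0 // mem_iota; lia.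
apply/eqP => /letter_inj; rewrite !mem_iota => e.
by have := e ltac:(lia) ltac:(lia); lia.
Qed.

Lemma iota_rcons m k : iota m k.+1 = rcons (iota m k) (m + k).
Proof. by rewrite -addn1 iotaD cats1. Qed.

Definition word := [seq w i | i <- iota 1 N].

Lemma word_perm : perm_eq word (iota 1 N).
Proof.
have uw : uniq word by rewrite map_inj_in_uniq ?iota_uniq //; exact: letter_inj.
apply: uniq_perm => //; first exact: iota_uniq.
have sub : {subset word <= iota 1 N}.
  move=> _ /mapP[i hi ->]; rewrite mem_iota letter_gt0 //=.
  by rewrite add1n ltnS letter_le.
by apply: (uniq_min_size uw sub _).2; rewrite size_map.
Qed.

(** The profile of the [j]-th letter in terms of positions; the terms [i = j]
and [i = N] of the last sum vanish. *)
Definition profile_at j := Profile (w j) (w j.-1 < w j) (w j < w j.+1)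
  (is_lmax s j) (is_rmax s j)
  (\sum_(1 <= i < j) ((w i > w j) && (w j > w i.+1)))
  (\sum_(j <= i < N.+1) ((w i < w j) && (w j < w i.+1))).

Lemma sumn_pairmap_iota (f : nat -> nat -> nat) a m :
  sumn (pairmap f (w a) [seq w i | i <- iota a.+1 m])
    = \sum_(a <= i < a + m) f (w i) (w i.+1).
Proof.
elim: m a => [|m IH] a /=; first by rewrite addn0 big_geq.
by rewrite IH addnS [RHS]big_ltn // ltnS leq_addr.
Qed.

Lemma profiles_word : profiles [::] word = [seq profile_at j | j <- iota 1 N].
Proof.
suff gen k m : k + m = N ->
    profiles [seq w i | i <- iota 1 k] [seq w i | i <- iota k.+1 m]
    = [seq profile_at j | j <- iota k.+1 m] by exact: (gen 0).
elim: m k => [|m IH] k //= kmN.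
have lastk : rcons [seq w i | i <- iota 1 k] (w k.+1)
    = [seq w i | i <- iota 1 k.+1].
  by rewrite -map_rcons -add1n -iota_rcons.
rewrite lastk IH; last by rewrite -kmN addnS.
congr cons; rewrite /profile_of /profile_at; congr Profile.
- by case: (k) => // k'; rewrite iota_rcons map_rcons last_rcons.
- by case: (m) kmN => //= kN; rewrite (@letter_out k.+2) // -kN addn1.
- by rewrite all_map.
- by rewrite all_map /is_rmax (_ : (N - k.+1)%N = m) //; move: kmN; clear; lia.
- rewrite /drops_in lastk -[0]/(w 0) sumn_pairmap_iota add0n big_ltn //.
  rewrite {1}/crossing_drop andbF add0n.
  by apply: eq_bigr => i _; rewrite /crossing_drop andbC.
- rewrite /rises_in (_ : rcons _ 0 = [seq w i | i <- iota k.+2 m.+1]); last first.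
    rewrite iota_rcons map_rcons (@letter_out (k.+2 + m)) //; lia.
  rewrite sumn_pairmap_iota (_ : k.+1 + m.+1 = N.+1) //; lia.
Qed.

Hypothesis N_gt0 : 0 < N.
Local Notation S := (profiles [::] word).

Lemma count_profiles (P : pred profile) (a : pred nat) :
  (forall i, 0 < i <= N -> w i.-1 != w i -> w i != w i.+1 -> P (profile_at i) = a i) ->
  count P S = count a (iota 1 N).
Proof.
move=> e; rewrite profiles_word count_map; apply: eq_in_count => i.
rewrite mem_iota add1n ltnS => h /=; apply: e => //.
  have := @letter_adjacent i.-1 N_gt0.
  by case: i h => // i /andP[_ /ltnW]/[swap]; apply.
by apply: letter_adjacent => //; case/andP: h.
Qed.

Lemma is_peak_at i : w i != w i.+1 -> is_peak (profile_at i) = peak s i.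
Proof. by rewrite /is_peak /peak /=; lia. Qed.

Lemma is_valley_at i : w i.-1 != w i -> is_valley (profile_at i) = valley s i.
Proof. by rewrite /is_valley /valley /=; lia. Qed.

Lemma lmaxpk_profiles : lmaxpk s = count (fun p => ltr_max p && is_peak p) S.
Proof.
rewrite (count_profiles (a := fun i => is_lmax s i && peak s i)) // => i _ _ h.
by rewrite is_peak_at.
Qed.

Lemma rmaxpk_profiles : rmaxpk s = count (fun p => rtl_max p && is_peak p) S.
Proof.
rewrite (count_profiles (a := fun i => is_rmax s i && peak s i)) // => i _ _ h.
by rewrite is_peak_at.
Qed.

Lemma lmaxda_profiles : lmaxda s = count (fun p => is_dasc p && ltr_max p) S.
Proof.
rewrite (count_profiles (a := fun i => is_lmax s i && dasc s i)) // => i _ _ h.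
by rewrite andbC.
Qed.

Lemma is_ddesc_at i : w i.-1 != w i -> w i != w i.+1 ->
  is_ddesc (profile_at i) = ddesc s i.
Proof. by rewrite /is_ddesc /ddesc /=; lia. Qed.

Lemma rmaxdd_profiles : rmaxdd s = count (fun p => is_ddesc p && rtl_max p) S.
Proof.
rewrite (count_profiles (a := fun i => is_rmax s i && ddesc s i)) // => i _ h1 h2.
by rewrite is_ddesc_at // andbC.
Qed.

Lemma dd_profiles : dd s = count is_ddesc S.
Proof.
by rewrite (count_profiles (a := ddesc s)) // => i _; apply: is_ddesc_at.
Qed.

Lemma count_predI (T : Type) (P Q : pred T) (t : seq T) :
  (count (fun p => P p && Q p) t + count (fun p => P p && ~~ Q p) t = count P t)%N.
Proof. by elim: t => //= x t <-; case: (P x) (Q x) => -[] /=; lia. Qed.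

Lemma lmax_enters i : i \in iota 1 N -> is_lmax s i -> w i.-1 < w i.
Proof.
case: i => [|[|i]] hi L; [by rewrite mem_iota in hi | exact: letter_gt0 |].
by apply: (allP L); rewrite mem_iota /=; move: hi; rewrite mem_iota; lia.
Qed.

Lemma rmax_leaves i : i \in iota 1 N -> is_rmax s i -> w i.+1 <= w i.
Proof.
rewrite mem_iota => hi L; have [iN|iN] := ltnP i N; last by rewrite (@letter_out i.+1).
by apply/ltnW/(allP L); rewrite mem_iota; lia.
Qed.

(** A left-to-right maximum is entered by a rise, so it is a peak or a double
ascent. *)
Lemma lmax_profiles : lmax s = lmaxpk s + lmaxda s.
Proof.
rewrite lmaxpk_profiles lmaxda_profiles -[LHS](count_profiles (P := ltr_max)) //.
rewrite -(count_predI ltr_max rise_out) addnC profiles_word !count_map.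
congr (_ + _); apply: eq_in_count => i hi /=; rewrite /is_peak /is_dasc /=;
  by case L: (is_lmax s i); rewrite ?andbF // (lmax_enters hi L) ?andbT.
Qed.

(** A right-to-left maximum is left by a fall, so it is a peak or a double
descent. *)
Lemma rmax_profiles : rmax s = rmaxpk s + rmaxdd s.
Proof.
rewrite rmaxpk_profiles rmaxdd_profiles -[LHS](count_profiles (P := rtl_max)) //.
rewrite -(count_predI rtl_max rise_in) profiles_word !count_map.
congr (_ + _); apply: eq_in_count => i hi /=; rewrite /is_peak /is_ddesc /=;
  case L: (is_rmax s i); rewrite ?andbF // (ltnNge (w i)) (rmax_leaves hi L) ?andbT //.
Qed.

Lemma p31_2_profiles : p31_2 s = \sum_(p <- S) drops p.
Proof. by rewrite profiles_word big_map /p31_2 /index_iota subn1. Qed.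

Lemma p2_13_profiles : p2_13 s = \sum_(p <- S) rises p.
Proof.
rewrite profiles_word big_map (_ : iota 1 N = index_iota 1 N.+1); last first.
  by rewrite /index_iota subn1.
apply: (exchange_triangle (F := fun i j => (w j < w i) && (w i < w j.+1))) => //.
  by move=> i; rewrite ltnn.
by move=> i; rewrite (@letter_out N.+1) // andbF.
Qed.

(** The bottom of a descent is a valley or a double descent. *)
Lemma des_profiles : des s = count is_valley S + count is_ddesc S.
Proof.
transitivity (count (fun p => ~~ rise_in p) S); last first.
  by rewrite -(count_predI _ rise_out).
rewrite (count_profiles (P := fun p => ~~ rise_in p)
  (a := fun i => w i.-1 > w i)); last first.
  by move=> i _ h _ /=; move: h; lia.
have -> : iota 1 N = 1 :: [seq 1 + i | i <- iota 1 N.-1].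
  by rewrite -iotaDl -[in LHS](prednK N_gt0).
by rewrite /= count_map.
Qed.

(** Counted by their tops, the descents of the word followed by 0 are the peaks
and the double descents, and there is one more of them than descents proper. *)
Lemma peak_valley_profiles : count is_peak S = (count is_valley S).+1.
Proof.
suff: count is_peak S + count is_ddesc S = (des s).+1 by rewrite des_profiles; lia.
transitivity (count (fun p => ~~ rise_out p) S).
  rewrite -(count_predI (fun p => ~~ rise_out p) rise_in) /=; congr (_ + _);
  by apply: eq_count => p; rewrite andbC.
rewrite (count_profiles (P := fun p => ~~ rise_out p)
  (a := fun i => w i > w i.+1)); last first.
  by move=> i _ _ h /=; move: h; lia.
have -> : iota 1 N = iota 1 N.-1 ++ [:: N].
  by rewrite -[in LHS](prednK N_gt0) iota_rcons cats1 add1n prednK.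
rewrite count_cat /= addn0.
rewrite (@letter_out N.+1) // letter_gt0 ?addn1 //.
by rewrite mem_iota; lia.
Qed.

Lemma dasc_profiles :
  N = count is_dasc S + count is_ddesc S + (count is_valley S).*2.+1.
Proof.
have : size S = N by rewrite profiles_word size_map size_iota.
rewrite -(count_predT S) -(count_predI predT rise_in).
rewrite -(count_predI (fun p => predT p && rise_in p) rise_out).
rewrite -(count_predI (fun p => predT p && ~~ rise_in p) rise_out).
by have := peak_valley_profiles; rewrite /is_peak /is_valley /is_dasc /is_ddesc /=; lia.
Qed.

Lemma position_adjacent i : i \in iota 1 N -> w i.-1 != w i /\ w i != w i.+1.
Proof.
rewrite mem_iota add1n ltnS; case: i => // i /= iN.
by split; apply: letter_adjacent => //; apply: ltnW.
Qed.

Lemma Dstat_profiles : Dstat s =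
  ((\sum_(p <- S | is_peak p && (value p != N)) value p)%:Z
   - (\sum_(p <- S | is_valley p) value p)%:Z)%R.
Proof.
rewrite /Dstat /Pk /Val !big_map !big_filter_cond profiles_word !big_map.
congr (_%:Z - _%:Z)%R; rewrite big_seq_cond [RHS]big_seq_cond; apply: eq_bigl => i /=;
  case iN: (i \in _) => //=; have [h1 h2] := position_adjacent iN.
  by rewrite is_peak_at.
by rewrite is_valley_at ?andbT.
Qed.

Lemma letter_lt_top m i : m \in iota 1 N -> w m = N -> i \in iota 1 N ->
  i != m -> w i < w m.
Proof.
move=> mN wm iN im; rewrite ltn_neqAle {2}wm letter_le andbT.
by apply: contra im => /eqP /letter_inj ->.
Qed.

Lemma lmaxpk_top m : m \in iota 1 N -> w m = N -> is_lmax s m && peak s m.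
Proof.
move=> mN wm; have [h1 h2] := position_adjacent mN.
apply/andP; split; last first.
  by rewrite /peak; have := letter_le m.-1; have := letter_le m.+1; lia.
apply/allP => j; have := mN; rewrite !mem_iota => h jm.
by apply: letter_lt_top => //; rewrite ?mem_iota; lia.
Qed.

Lemma exists_top : exists2 m, m \in iota 1 N & w m = N.
Proof.
have: N \in word by rewrite (perm_mem word_perm) mem_iota; lia.
by case/mapP => m; exists m.
Qed.

Lemma first_descentP :
  let d := first_descent s in
  [/\ d \in iota 1 N, w d.+1 < w d & forall i, 0 < i < d -> w i < w i.+1].
Proof.
set P := fun i => w i > w i.+1.
have hP : has P (iota 1 N).
  apply/hasP; exists N; first by rewrite mem_iota; lia.
  by rewrite /P (@letter_out N.+1) // letter_gt0 // mem_iota; lia.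
have lt : find P (iota 1 N) < N by rewrite -[X in _ < X](size_iota 1) -has_find.
split; rewrite /first_descent -/P.
- by rewrite mem_iota; lia.
- by have := nth_find 0 hP; rewrite nth_iota // add1n.
move=> i /andP[i0 ilt].
have h : i.-1 < find P (iota 1 N) by lia.
have := before_find 0 h; rewrite nth_iota ?(ltn_trans h) // add1n prednK // /P.
by have := @letter_adjacent i N_gt0; lia.
Qed.

Lemma lmaxpk_first_descent :
  is_lmax s (first_descent s) && peak s (first_descent s).
Proof.
have [dN dd asc] := first_descentP; move: (first_descent s) dN dd asc => d.
rewrite mem_iota => dN dd asc.
have incr i j : 0 < i -> i + j < d -> w i < w (i + j).+1.
  move=> i0; elim: j => [|j IH] ij; first by rewrite addn0 in ij *; apply: asc; lia.
  by rewrite addnS in ij *; apply: ltn_trans (IH _) (asc _ _); lia.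
have lm : is_lmax s d.
  apply/allP => j; rewrite mem_iota => jd.
  by rewrite (_ : d = (j + (d.-1 - j)).+1); [apply: incr|]; lia.
by rewrite lm /peak dd lmax_enters ?mem_iota.
Qed.

Lemma lmaxpk_gt0 : 0 < lmaxpk s.
Proof.
have [m mN wm] := exists_top; rewrite /lmaxpk -has_count.
by apply/hasP; exists m => //; apply: lmaxpk_top.
Qed.

Lemma rmaxpk_gt0 : 0 < rmaxpk s.
Proof.
have [m mN wm] := exists_top; rewrite /rmaxpk -has_count.
apply/hasP; exists m => //; have /andP[_ ->] := lmaxpk_top mN wm; rewrite andbT.
apply/allP => j; have := mN; rewrite !mem_iota => h jm.
by apply: letter_lt_top => //; rewrite ?mem_iota; lia.
Qed.

(** The first descent and the letter N are both peaks and left-to-right maxima,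
so they coincide when there is only one such peak.  Conversely, if the first
descent is at N, there is no peak before it and no left-to-right maximum after
it. *)
Lemma lmaxpk_PRW : (lmaxpk s == 1) = (s \in PRW N).
Proof.
rewrite inE; have [dN dd asc] := first_descentP; have dP := lmaxpk_first_descent.
move: (first_descent s) dN dd asc dP => d dN dd asc dP.
have [m mN wm] := exists_top; have mP := lmaxpk_top mN wm.
apply/eqP/eqP => [|wd].
  rewrite /lmaxpk -size_filter.
  have := mem_filter (fun i => is_lmax s i && peak s i) ^~ (iota 1 N).
  case: filter => [|z [|? ?]] //= M _.
  have := M d; have := M m; rewrite !inE dN mN dP mP => /eqP mz /eqP dz.
  by rewrite dz -mz.
rewrite /lmaxpk (eq_in_count (a2 := pred1 d)); last first.
  move=> i iN /=; apply/idP/eqP => [/andP[li pi]|->]; last exact: dP.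
  move: iN; rewrite mem_iota => iN; case: (ltngtP i d) => // id.
    by have := asc i; move: pi; rewrite /peak; lia.
  have : w d < w i by apply: (allP li); move: dN; rewrite !mem_iota; lia.
  by rewrite wd ltnNge letter_le.
by rewrite count_uniq_mem ?iota_uniq // dN.
Qed.

End Letters.

Lemma word_inj N : injective (@word N).
Proof.
move=> s s' e; apply/permP => i.
have : letter s i.+1 = letter s' i.+1.
  have := congr1 (fun u => nth 0%N u i) e.
  by rewrite /word !(nth_map 0%N) ?size_iota // !nth_iota // add1n.
by rewrite !letter_ord => -[] /val_inj.
Qed.

Lemma sum_words (R : nmodType) N (F : seq nat -> R) :
  \sum_(s : 'S_N) F (word s) = \sum_(u <- permutations (iota 1 N)) F u.
Proof.
rewrite -(big_map (@word N) xpredT F); apply: perm_big.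
have uw : uniq [seq word s | s <- index_enum 'S_N].
  by rewrite map_inj_uniq ?index_enum_uniq //; exact: word_inj.
apply: uniq_perm => //; first exact: permutations_uniq.
apply: (uniq_min_size uw _ _).2.
  by move=> _ /mapP[s _ ->]; rewrite mem_permutations word_perm.
rewrite size_permutations ?iota_uniq // size_iota size_map -card_Sn.
by rewrite cardE enumT.
Qed.

(** * The gamma-expansions *)

Lemma count_skeleton (P : pred profile) S :
  (forall p, P p -> ~~ flat p) -> count P (skeleton S) = count P S.
Proof.
move=> Pf; rewrite /skeleton count_filter; apply: eq_count => p /=.
by case Pp: (P p) => //=; apply: Pf.
Qed.

Lemma big_skeleton (P : pred profile) (F : profile -> nat) S :
  (forall p, P p -> ~~ flat p) ->
  (\sum_(p <- skeleton S | P p) F p = \sum_(p <- S | P p) F p)%N.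
Proof.
move=> Pf; rewrite /skeleton big_filter_cond; apply: eq_bigl => p /=.
by case Pp: (P p); rewrite ?andbF // andbT; apply: Pf.
Qed.

Lemma peak_not_flat p : is_peak p -> ~~ flat p.
Proof. by rewrite /is_peak /flat; case: (rise_in p) (rise_out p) => -[]. Qed.

Lemma valley_not_flat p : is_valley p -> ~~ flat p.
Proof. by rewrite /is_valley /flat; case: (rise_in p) (rise_out p) => -[]. Qed.

Lemma big_marked (R : comNzRingType) (x : R) S :
  \prod_(p <- S) marked x p = x ^+ count is_ddesc S.
Proof. by rewrite /marked -big_mkcond big_const_seq iter_mulr_1. Qed.

Lemma big_resolved (R : comNzRingType) (x : R) S :
  \prod_(p <- S) resolved x p
    = if count is_ddesc S == 0%N then (1 + x) ^+ count is_dasc S else 0.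
Proof.
elim: S => [|p S IH]; first by rewrite big_nil.
rewrite big_cons IH /= addn_eq0 eqb0 /resolved.
case Dp: (is_ddesc p) => /=; first by rewrite mul0r.
case Ap: (is_dasc p); case: ifP => _; by rewrite ?mulr0 ?exprS ?mul1r.
Qed.

#[local] Arguments profiles : simpl never.

Section Gamma.
Variables (R : comNzRingType) (n : nat) (x : R).
Variables (K : seq profile -> R) (rho : profile -> R).
Hypothesis rho_balanced : balanced rho.
Local Notation S s := (profiles [::] (word s)).
Let T (s : 'S_n.+1) := K (skeleton (S s)) * \prod_(p <- S s) rho p.

(** Any weight that splits into a function of the skeleton and a balanced
product over the letters has a gamma-expansion on PRW. *)
Lemma gamma_expansion :
  \sum_(s : 'S_n.+1) x ^+ des s * 0 ^+ (lmaxpk s - 1) * T s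
    = \sum_(0 <= k < n./2.+1)
        (\sum_(s in PRWdd0 n.+1 k) T s) * x ^+ k * (1 + x) ^+ (n - 2 * k).
Proof.
pose K' t := x ^+ count is_valley t
  * 0 ^+ (count (fun p => ltr_max p && is_peak p) t - 1) * K t.
have K'E (s : 'S_n.+1) : K' (skeleton (S s))
    = x ^+ count is_valley (S s) * 0 ^+ (lmaxpk s - 1) * K (skeleton (S s)).
  rewrite /K' lmaxpk_profiles // !count_skeleton // => p; last exact: valley_not_flat.
  by case/andP=> _; apply: peak_not_flat.
transitivity (\sum_(s : 'S_n.+1)
    word_weight K' (fun p => rho p * resolved x p) (word s)).
  rewrite (sum_words n.+1 (word_weight _ _)) -toggle ?iota_uniq ?mem_iota //.
  rewrite -(sum_words n.+1 (word_weight _ _)); apply: eq_bigr => s _.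
  rewrite /word_weight K'E big_split big_marked des_profiles // exprD /T /=.
  by ring.
transitivity (\sum_(s in PRW n.+1 | dd s == 0%N)
    T s * x ^+ des s * (1 + x) ^+ (n - 2 * des s)).
  rewrite [RHS]big_mkcond; apply: eq_bigr => s _.
  rewrite /word_weight K'E big_split big_resolved -dd_profiles // -lmaxpk_PRW //.
  have L := lmaxpk_gt0 s (ltn0Sn n).
  case: (dd s =P 0%N) => [d0|_]; last by rewrite andbF /= !mulr0.
  rewrite andbT.
  have := dasc_profiles s (ltn0Sn n); have := des_profiles s (ltn0Sn n).
  rewrite -dd_profiles // d0 addn0 => -> cn.
  rewrite (_ : count is_dasc (S s) = n - 2 * count is_valley (S s))%N; last by lia.
  case: (lmaxpk s =P 1%N) => [->|/eqP l1]; last first.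
    by rewrite expr0n (_ : (_ == 0)%N = false) ?mulr0 ?mul0r //; lia.
  by rewrite subnn expr0 /T /=; ring.
under [RHS]eq_bigr do rewrite -mulrA mulr_suml.
rewrite (exchange_big_dep (fun s => (s \in PRW n.+1) && (dd s == 0%N))) /=; last first.
  by move=> k s _; rewrite inE => /and3P[-> ->].
apply: eq_bigr => s /andP[sP /eqP d0].
rewrite (eq_bigl (fun k => k == des s)); last first.
  by move=> k; rewrite inE sP d0 eqxx /= eq_sym.
have := dasc_profiles s (ltn0Sn n); have := des_profiles s (ltn0Sn n).
rewrite -dd_profiles // d0 => e1 e2.
by rewrite big_nat1_eq ifT ?mulrA //; lia.
Qed.
End Gamma.

Section Statistics.
Variables (R : comUnitRingType) (n : nat) (g h p q t alpha : R).
Local Notation S s := (profiles [::] (word s)).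

(** The power of [h] is kept as one function of the skeleton: for [h] not
invertible it is not a product over the letters. *)
Definition skeleton_weight (T : seq profile) : R :=
  g ^+ (count (fun p => rtl_max p && is_peak p) T - 1)
  * h ^ ((\sum_(p <- T | is_peak p && (value p != n.+1)) value p)%:Z
         - (\sum_(p <- T | is_valley p) value p)%:Z).

Lemma skeleton_weightE (s : 'S_n.+1) :
  skeleton_weight (skeleton (S s)) = g ^+ (rmaxpk s - 1) * h ^ Dstat s.
Proof.
rewrite /skeleton_weight Dstat_profiles // rmaxpk_profiles // count_skeleton; last first.
  by move=> r /andP[_]; apply: peak_not_flat.
rewrite !big_skeleton // => r; first exact: valley_not_flat.
by case/andP=> + _; apply: peak_not_flat.
Qed.

Lemma crossings_weightE (s : 'S_n.+1) :
  \prod_(r <- S s) (p ^+ drops r * q ^+ rises r)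
    = p ^+ p31_2 s * q ^+ p2_13 s.
Proof. by rewrite big_split !prodrXr p31_2_profiles // p2_13_profiles. Qed.

(** The part of alpha^(lmax + rmax - 2) due to the records that are peaks. *)
Definition peak_records_weight (T : seq profile) : R :=
  alpha ^+ (count (fun p => ltr_max p && is_peak p) T
            + count (fun p => rtl_max p && is_peak p) T - 2).

Lemma records_weightE (s : 'S_n.+1) :
  peak_records_weight (skeleton (S s))
  * \prod_(r <- S s) (t * alpha) ^+ (is_dasc r && ltr_max r || is_ddesc r && rtl_max r)
    = t ^+ (lmaxda s + rmaxdd s) * alpha ^+ (lmax s + rmax s - 2).
Proof.
have -> : \prod_(r <- S s)
      (t * alpha) ^+ (is_dasc r && ltr_max r || is_ddesc r && rtl_max r)
    = (t * alpha) ^+ (lmaxda s + rmaxdd s).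
  rewrite lmaxda_profiles // rmaxdd_profiles // prodrXr; congr (_ ^+ _).
  elim: (S s) => [|r T IH]; first by rewrite big_nil.
  rewrite big_cons IH /= /is_dasc /is_ddesc.
  by case: (rise_in r) (rise_out r) (ltr_max r) (rtl_max r) => -[] [] [] /=; lia.
have -> : peak_records_weight (skeleton (S s)) = alpha ^+ (lmaxpk s + rmaxpk s - 2).
  rewrite /peak_records_weight lmaxpk_profiles // rmaxpk_profiles //.
  by rewrite !count_skeleton // => r /andP[_]; apply: peak_not_flat.
rewrite exprMn mulrCA -exprD; congr (_ * _ ^+ _).
have := lmaxpk_gt0 s (ltn0Sn n); have := rmaxpk_gt0 s (ltn0Sn n).
by have := lmax_profiles s (ltn0Sn n); have := rmax_profiles s (ltn0Sn n); lia.
Qed.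
End Statistics.

Theorem theorem2p6 (R : comUnitRingType) (n : nat)
    (x g h p q t alpha : R) :
  A n x 0 g h p q
    = \sum_(0 <= k < n./2.+1)
        gamma_a0 n k g h p q * x ^+ k * (1 + x) ^+ (n - 2 * k)
  /\
  B n x 0 g h t alpha
    = \sum_(0 <= k < n./2.+1)
        gamma_b0 n k g h t alpha * x ^+ k * (1 + x) ^+ (n - 2 * k).
Proof.
split.
  transitivity (\sum_(0 <= k < n./2.+1) (\sum_(s in PRWdd0 n.+1 k)
      skeleton_weight n g h (skeleton (profiles [::] (word s)))
      * \prod_(r <- profiles [::] (word s)) (p ^+ drops r * q ^+ rises r))
      * x ^+ k * (1 + x) ^+ (n - 2 * k)).
    rewrite -gamma_expansion; last exact: balanced_crossings.
    apply: eq_bigr => s _; rewrite skeleton_weightE crossings_weightE; ring.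
  apply: eq_bigr => k _; congr (_ * _ * _); apply: eq_bigr => s _.
  by rewrite skeleton_weightE crossings_weightE mulrA.
pose K T := skeleton_weight n g h T * peak_records_weight alpha T.
pose rho r := (t * alpha) ^+ (is_dasc r && ltr_max r || is_ddesc r && rtl_max r).
have KE (s : 'S_n.+1) : K (skeleton (profiles [::] (word s)))
    * \prod_(r <- profiles [::] (word s)) rho r
    = g ^+ (rmaxpk s - 1) * h ^ Dstat s
      * t ^+ (lmaxda s + rmaxdd s) * alpha ^+ (lmax s + rmax s - 2).
  by rewrite /K -mulrA records_weightE skeleton_weightE !mulrA.
transitivity (\sum_(0 <= k < n./2.+1) (\sum_(s in PRWdd0 n.+1 k)
    K (skeleton (profiles [::] (word s)))
    * \prod_(r <- profiles [::] (word s)) rho r)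
    * x ^+ k * (1 + x) ^+ (n - 2 * k)).
  rewrite -gamma_expansion; last exact: balanced_records.
  by apply: eq_bigr => s _; rewrite KE !mulrA.
apply: eq_bigr => k _; congr (_ * _ * _); apply: eq_bigr => s.
rewrite inE => /and3P[_ /eqP d0 _]; rewrite KE.
(* without double descents, [t ^+ lmaxda] is the full power of [t] *)
suff -> : rmaxdd s = 0%N by rewrite addn0.
apply/eqP; rewrite -leqn0 -d0; apply: sub_count => i /andP[].
by [].
Qed.
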